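(* Consider a spherical 4-bar linkage with sector angles satisfying $\alpha=\beta=\pi-\gamma=\pi-\delta\neq\pi/2$ (type ''Miura II''). (i) Finite solutions. There are two branches of flexes, each diffeomorphic to a circle $S^1$, with the parametrizations $$x\in\mathbb{R}\cup\{\infty\},\ y=0,\ z=x,\ w=0\qquad\text{or}\qquad x\in\mathbb{R}\cup\{\infty\},\ y=-\frac{x}{\cos\alpha},\ z=-x,\ w=-\frac{x}{\cos\alpha}.$$ (ii) Solutions at infinity. The solutions at infinity form another branch, diffeomorphic to a circle $S^1$: $$x\equiv\infty,\quad y\in\mathbb{R}\cup\{\infty\},\quad z\equiv\infty,\quad w=-y.$$
   Context: A spherical 4-bar linkage (equivalently, a degree-4 single-vertex rigid origami) is a closed chain of four great-circle arcs on the unit sphere with lengths (sector angles), in counter-clockwise cyclic order, $\alpha,\beta,\gamma,\delta\in(0,\pi)$. Its configuration is described by the folding angles (signed turning angles between consecutive arcs) $\rho_x,\rho_y,\rho_z,\rho_w\in\mathbb{R}/2\pi$, where $\rho_x$ is at the joint of $\alpha$ and $\beta$, $\rho_y$ of $\beta$ and $\gamma$, $\rho_z$ of $\gamma$ and $\delta$, $\rho_w$ of $\delta$ and $\alpha$. Write $x=\tan(\rho_x/2)$, $y=\tan(\rho_y/2)$, $z=\tan(\rho_z/2)$, $w=\tan(\rho_w/2)$, all in $\mathbb{R}\cup\{\infty\}$, the one-point compactification of the real line (folding angles $\pi$ and $-\pi$ are identified and correspond to $\infty$). Finite solutions are the flexes found with $x,y,z,w$ finite, each branch then being completed over $\mathbb{R}\cup\{\infty\}$;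 solutions at infinity are those with some of $x,y,z,w$ equal to $\infty$. For real $c\neq0$, $c\cdot\infty=\infty$. *)

(* Defs.v *)
From mathcomp Require Import all_boot all_order all_algebra.
From mathcomp Require Import all_classical all_reals all_analysis.
Set Implicit Arguments.
Unset Strict Implicit.
Unset Printing Implicit Defensive.
Import Order.TTheory GRing.Theory Num.Theory.
Import numFieldNormedType.Exports.
Local Open Scope classical_set_scope.
Local Open Scope ring_scope.

(* A traveller on the unit sphere carries the frame (position, direction of
   travel, left normal), written as the columns of F : 'M_3.  Advancing by an
   arc of length a replaces F by F *m arc_step a; turning left by r at the
   current position replaces F by F *m turn_step r. *)
Definition arc_step (R : realType) (a : R) : 'M[R]_3 :=
  \matrix_(i < 3, j < 3)
    nth 0 (nth [::] [:: [:: cos a; - sin a; 0];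
                        [:: sin a;   cos a; 0];
                        [:: 0;           0; 1]] i) j.

Definition turn_step (R : realType) (r : R) : 'M[R]_3 :=
  \matrix_(i < 3, j < 3)
    nth 0 (nth [::] [:: [:: 1;     0;       0];
                        [:: 0; cos r; - sin r];
                        [:: 0; sin r;   cos r]] i) j.

(* The chain alpha, rx, beta, ry, gamma, rz, delta, rw brings the frame back to
   itself.  Folding angles are given by real representatives mod 2 pi. *)
Definition linkage_closes (R : realType) (alpha beta gamma delta : R)
    (rx ry rz rw : R) : Prop :=
  arc_step alpha *m turn_step rx *m arc_step beta *m turn_step ry *m
  arc_step gamma *m turn_step rz *m arc_step delta *m turn_step rw = 1%:M.

Notation opcR R := (one_point_compactification R).

Definition fin (R : realType) (t : R) : opcR R := Some t.
Definition infty {R : realType} : opcR R := None.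

(* c * t with c * infty = infty; only used with c != 0. *)
Definition opc_scale (R : realType) (c : R) (t : opcR R) : opcR R :=
  if t is Some u then fin (c * u) else infty.

(* tan (r / 2), which identifies R / 2 pi with opcR R. *)
Definition half_tan (R : realType) (r : R) : opcR R :=
  if cos (r / 2) == 0 then infty else fin (tan (r / 2)).

Notation config R := (opcR R * opcR R * opcR R * opcR R)%type.

Definition half_tans (R : realType) (rx ry rz rw : R) : config R :=
  (half_tan rx, half_tan ry, half_tan rz, half_tan rw).

Definition solutions (R : realType) (alpha beta gamma delta : R) :
    set (config R) :=
  [set q | exists rx ry rz rw : R,
     linkage_closes alpha beta gamma delta rx ry rz rw /\
     q = half_tans rx ry rz rw].

Definition finite_configs (R : realType) : set (config R) :=
  [set q | exists x y z w : R, q = (fin x, fin y, fin z, fin w)].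

Definition finite_solutions (R : realType) (alpha beta gamma delta : R) :
    set (config R) :=
  solutions alpha beta gamma delta `&` @finite_configs R.

Definition solutions_at_infinity (R : realType) (alpha beta gamma delta : R) :
    set (config R) :=
  solutions alpha beta gamma delta `\` @finite_configs R.

(* C^k on an open set, through iterated directional derivatives; this is the
   usual notion when V is finite-dimensional, the only case used here. *)
Fixpoint Ck_on (R : realType) (V W : normedModType R) (k : nat) (U : set V)
    (f : V -> W) : Prop :=
  if k is k'.+1 then
    (forall p, U p -> differentiable f p) /\
    (forall v : V, Ck_on k' U (fun p => 'D_v f p))
  else forall p, U p -> {for p, continuous f}.

(* Smoothness of a map on an arbitrary subset of a normed space: local
   extendability to smooth maps on open sets. *)
Definition smooth_on (R : realType) (V W : normedModType R) (A : set V)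
    (f : V -> W) : Prop :=
  forall p, A p -> exists (U : set V) (F : V -> W),
    [/\ open U, U p, forall k, Ck_on k U F &
        forall q, A q -> U q -> F q = f q].

Definition diffeomorphic (R : realType) (V W : normedModType R)
    (A : set V) (B : set W) : Prop :=
  exists (f : V -> W) (g : W -> V),
    [/\ smooth_on A f, smooth_on B g,
        forall p, A p -> B (f p) /\ g (f p) = p &
        forall q, B q -> A (g q) /\ f (g q) = q].

Definition circle (R : realType) : set (R * R)%type :=
  [set p | p.1 ^+ 2 + p.2 ^+ 2 = 1].

Definition angle_pt (R : realType) (r : R) : (R * R)%type := (cos r, sin r).

(* The smooth structure of (R / 2 pi)^4 is that of the torus circle^4 in
   (R^2)^4; this is the set of configurations B seen in that torus. *)
Definition on_torus (R : realType) (B : set (config R)) :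
    set ((R * R) * (R * R) * (R * R) * (R * R))%type :=
  [set p | exists rx ry rz rw : R, B (half_tans rx ry rz rw) /\
     p = (angle_pt rx, angle_pt ry, angle_pt rz, angle_pt rw)].

Definition diffeomorphic_to_circle (R : realType) (B : set (config R)) : Prop :=
  diffeomorphic (on_torus B) (@circle R).

(* B is the completion over opcR R of its finite part. *)
Definition completed (R : realType) (B : set (config R)) : Prop :=
  closure (B `&` @finite_configs R) = B.

(* Main.v *)
Require Import Defs.
From mathcomp Require Import all_boot all_order all_algebra.
From mathcomp Require Import all_classical all_reals all_analysis.
From mathcomp Require Import ring lra.
Import Order.TTheory GRing.Theory Num.Theory.
Import numFieldNormedType.Exports.
Local Open Scope classical_set_scope.
Local Open Scope ring_scope.
Set Implicit Arguments.
Unset Strict Implicit.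
Unset Printing Implicit Defensive.

(** Cut the closed chain at the two joints [y] and [w].  Because [gamma] and
    [delta] are supplementary to [alpha], the half [gamma, rz, delta] travelled
    backwards is the same rotation matrix [M rz] as the half
    [alpha, rx, beta] is for [rx], so closure reads
    [M rx * turn ry = turn (- rw) * M rz].  Comparing entries gives
    [cos rz = cos rx].  If [rx = pi] the two halves fold back and only
    [rw = - ry] remains.  Otherwise [ry] and [rw] rotate a nonzero plane vector
    either onto itself ([rz = rx]) or onto its mirror image ([rz = - rx]),
    which gives the two finite branches.

    In the torus each branch is the graph, over one of its angles, of a map of
    the circle that is rational with nonvanishing denominator; the coordinate
    projection is therefore a diffeomorphism onto the circle.  Each finite
    branch is a continuous image of the compact space [opcR R] in a Hausdorff
    space, hence closed, and its finite part is dense in it. *)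

(** * Closure of the chain in half-tangents *)

Lemma sqr1D_neq0 (R : realDomainType) (t : R) : 1 + t ^+ 2 != 0.
Proof. by rewrite gt_eqF// ltr_wpDr ?sqr_ge0. Qed.

(** Inverse stereographic projection from (-1, 0): infinity goes to the centre of projection, the
    point of angle pi. *)
Definition opc_angle_pt (R : realType) (t : opcR R) : R * R :=
  if t is Some u then ((1 - u ^+ 2) / (1 + u ^+ 2), u *+ 2 / (1 + u ^+ 2))
  else (-1, 0).

(** The double-angle formulas; they turn closure from a condition on angles into rational identities
    in half-tangents. *)
Lemma angle_ptE (R : realType) (r : R) : angle_pt r = opc_angle_pt (half_tan r).
Proof.
have rE : r = (r / 2) *+ 2 by rewrite -mulr_natr divfK.
rewrite /half_tan {1}rE /angle_pt cos_mulr2n sin_mulr2n.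
set h := r / 2; case: (eqVneq (cos h) 0) => [->|h0] /=.
  by rewrite expr0n mul0rn sub0r mul0r mul0rn.
have h1 : 1 + tan h ^+ 2 = (cos h ^+ 2)^-1 by rewrite cos2_tan2.
rewrite h1 invrK; have := cos2Dsin2 h; rewrite /tan => cs.
by congr pair; [rewrite -[in LHS]cs|]; field.
Qed.

Lemma half_tan_surj (R : realType) (t : opcR R) : exists r, half_tan r = t.
Proof.
case: t => [t|]; last by exists pi; rewrite /half_tan cos_pihalf eqxx.
exists (atan t * 2); rewrite /half_tan mulfK// atanK.
rewrite gt_eqF// cos_gt0_pihalf//.
by rewrite atan_gtNpi2 atan_ltpi2.
Qed.

Lemma opc_angle_pt_image (R : realType) : range (@opc_angle_pt R) = @circle R.
Proof.
apply/seteqP; split=> [_ [t _ <-]|[c s]]; rewrite /circle/=.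
  case: t => [t|] /=; last by ring.
  by field; exact: sqr1D_neq0.
move=> cs; have [c1|c1] := eqVneq (1 + c) 0.
  exists infty => //=; have cE : c = -1 by apply/eqP; rewrite eq_sym -subr_eq0; lra.
  have /eqP : s ^+ 2 = 0 by move: cs; rewrite cE => ?; lra.
  by rewrite sqrf_eq0 => /eqP->; rewrite cE.
(* Half-angle formula: tan (r / 2) = sin r / (1 + cos r). *)
exists (fin (s / (1 + c))) => //=.
have s2 : s ^+ 2 = (1 - c) * (1 + c) by rewrite -subr_sqr expr1n -cs; ring.
have e : 1 + (s / (1 + c)) ^+ 2 = 2 / (1 + c) by rewrite expr_div_n s2; field.
have e' : 1 - (s / (1 + c)) ^+ 2 = 2 * c / (1 + c) by rewrite expr_div_n s2; field.
by rewrite e e'; congr pair; field.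
Qed.

(** Taking a point of the circle instead of an angle lets half-tangents, infinity included, be
    substituted through [opc_angle_pt]. *)
Definition turn_mx (R : realType) (p : R * R) : 'M[R]_3 :=
  \matrix_(i < 3, j < 3)
    nth 0 (nth [::] [:: [:: 1; 0; 0]; [:: 0; p.1; - p.2]; [:: 0; p.2; p.1]] i) j.

Definition fold_mx (R : realType) (a : R) (p : R * R) : 'M[R]_3 :=
  \matrix_(i < 3, j < 3)
    nth 0 (nth [::]
      [:: [:: cos a ^+ 2 - sin a ^+ 2 * p.1; - (cos a * sin a * (1 + p.1)); sin a * p.2];
          [:: cos a * sin a * (1 + p.1); cos a ^+ 2 * p.1 - sin a ^+ 2; - (cos a * p.2)];
          [:: sin a * p.2; cos a * p.2; p.1]] i) j.

Lemma fold_mxE (R : realType) (a r : R) :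
  arc_step a *m turn_step r *m arc_step a = fold_mx a (angle_pt r).
Proof.
apply/matrixP => i j; rewrite !mxE !big_ord_recl !big_ord0 !mxE.
rewrite !big_ord_recl !big_ord0 !mxE.
case: i => [[|[|[|//]]]] ?; case: j => [[|[|[|//]]]] ? /=; ring.
Qed.

Lemma arc_stepK (R : realType) (a : R) : arc_step a *m arc_step (- a) = 1%:M.
Proof.
have cs := cos2Dsin2 a.
apply/matrixP => i j; rewrite !mxE !big_ord_recl !big_ord0 !mxE cosN sinN.
by case: i => [[|[|[|//]]]] ?; case: j => [[|[|[|//]]]] ? /=; first [ring | rewrite -[RHS]cs; ring].
Qed.

Lemma turn_stepK (R : realType) (a : R) : turn_step a *m turn_step (- a) = 1%:M.
Proof.
have cs := cos2Dsin2 a.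
apply/matrixP => i j; rewrite !mxE !big_ord_recl !big_ord0 !mxE cosN sinN.
by case: i => [[|[|[|//]]]] ?; case: j => [[|[|[|//]]]] ? /=; first [ring | rewrite -[RHS]cs; ring].
Qed.

Lemma mulmx_eq_shift (R : comUnitRingType) n (A U V B : 'M[R]_n) : U *m V = 1%:M ->
  (A *m U = B) <-> (A = B *m V).
Proof.
move=> UV; have VU := mulmx1C UV.
by split=> [<-|->]; rewrite -mulmxA ?UV ?VU mulmx1.
Qed.

(* The two arcs of length [pi - a], travelled backwards, fold exactly as two
   arcs of length [a]. *)
Lemma miura_closesP (R : realType) (a rx ry rz rw : R) :
  linkage_closes a a (pi - a) (pi - a) rx ry rz rw <->
  fold_mx a (angle_pt rx) *m turn_mx (angle_pt ry) =
  turn_mx (angle_pt (- rw)) *m fold_mx a (angle_pt rz).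
Proof.
rewrite /linkage_closes fold_mxE.
rewrite (mulmx_eq_shift _ _ (turn_stepK rw)).
rewrite (mulmx_eq_shift _ _ (arc_stepK _)).
rewrite (mulmx_eq_shift _ _ (turn_stepK rz)).
rewrite (mulmx_eq_shift _ _ (arc_stepK _)) mul1mx.
rewrite -2!mulmxA (mulmxA (arc_step _)) fold_mxE.
(* Replacing [a] by [a - pi] negates its sine and cosine, and reversing the turn negates the second
   coordinate. Each entry of [fold_mx] is invariant under these three sign changes made together. *)
have -> : fold_mx (- (pi - a)) (angle_pt (- rz)) = fold_mx a (angle_pt rz).
  have sE : sin (- (pi - a)) = - sin a by rewrite opprB -[in RHS](subrK pi a) sinDpi opprK.
  have cE : cos (- (pi - a)) = - cos a by rewrite opprB -[in RHS](subrK pi a) cosDpi opprK.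
  apply/matrixP => i j; rewrite !mxE /= sE cE cosN sinN.
  by case: i => [[|[|[|//]]]] ?; case: j => [[|[|[|//]]]] ? /=; ring.
by [].
Qed.

(** One plus the first coordinate is 2 / (1 + t^2), nonzero exactly for finite [t], and [t] is then
    the ratio of the second coordinate to it. *)
Lemma opc_angle_pt_inj (R : realType) : injective (@opc_angle_pt R).
Proof.
have n1 (t : R) : (1 - t ^+ 2) / (1 + t ^+ 2) <> -1.
  by have := sqr1D_neq0 t => t0 /(congr1 ( *%R^~ (1 + t ^+ 2))); rewrite divfK//; lra.
move=> [t|] [u|] //= []; [|by move/n1|by move/esym/n1].
have t0 := sqr1D_neq0 t; have u0 := sqr1D_neq0 u.
have D (v : R) : 1 + v ^+ 2 != 0 -> (1 - v ^+ 2) / (1 + v ^+ 2) + 1 = 2 / (1 + v ^+ 2).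
  by move=> ?; field.
have S (v : R) : 1 + v ^+ 2 != 0 -> v *+ 2 / (1 + v ^+ 2) = v * (2 / (1 + v ^+ 2)).
  by move=> ?; field.
move=> /(congr1 ( +%R^~ 1)); rewrite !D// !S// => -> /mulIf -> //.
by rewrite mulf_neq0// invr_neq0.
Qed.

Lemma sqrDsqr_neq0 (R : realDomainType) (c t : R) : c != 0 -> c ^+ 2 + t ^+ 2 != 0.
Proof.
by move=> c0; rewrite gt_eqF// ltr_wpDr ?sqr_ge0// lt_neqAle sqr_ge0 eq_sym sqrf_eq0 c0.
Qed.

(** A rotation fixing the nonzero vector (c, t) is the identity. Cosine and sine are recovered from
    the linear system of determinant c^2 + t^2. *)
Lemma rotate_fix (R : realType) (c t : R) (y : opcR R) : c != 0 ->
  c * (opc_angle_pt y).1 - t * (opc_angle_pt y).2 = c ->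
  c * (opc_angle_pt y).2 + t * (opc_angle_pt y).1 = t -> y = fin 0.
Proof.
move=> c0; case E: (opc_angle_pt y) => [cy sy] /= e1 e2.
have n0 := sqrDsqr_neq0 t c0.
apply: opc_angle_pt_inj; rewrite E /=; congr pair; apply: (mulfI n0).
  have -> : (c ^+ 2 + t ^+ 2) * cy = c * (c * cy - t * sy) + t * (c * sy + t * cy) by ring.
  by rewrite e1 e2; field.
have -> : (c ^+ 2 + t ^+ 2) * sy = c * (c * sy + t * cy) - t * (c * cy - t * sy) by ring.
by rewrite e1 e2; field.
Qed.

(** The rotation carrying (c, t) to its mirror image (c, -t) turns by minus twice the argument of
    (c, t), so its half-tangent is -t / c. *)
Lemma rotate_flip (R : realType) (c t : R) (y : opcR R) : c != 0 ->
  c * (opc_angle_pt y).1 - t * (opc_angle_pt y).2 = c ->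
  c * (opc_angle_pt y).2 + t * (opc_angle_pt y).1 = - t -> y = fin (- c^-1 * t).
Proof.
move=> c0; case E: (opc_angle_pt y) => [cy sy] /= e1 e2.
have n0 := sqrDsqr_neq0 t c0.
apply: opc_angle_pt_inj; rewrite E /=; congr pair; apply: (mulfI n0).
  have -> : (c ^+ 2 + t ^+ 2) * cy = c * (c * cy - t * sy) + t * (c * sy + t * cy) by ring.
  by rewrite e1 e2; field; rewrite c0 mulN1r sqrrN n0.
have -> : (c ^+ 2 + t ^+ 2) * sy = c * (c * sy + t * cy) - t * (c * cy - t * sy) by ring.
by rewrite e1 e2; field; rewrite c0 mulN1r sqrrN n0.
Qed.

(** The first row and first column, divided by [sin a], say that the turns by [y] and by [w] both
    rotate (cos a (1 + x.1), x.2) to (cos a (1 + z.1), z.2). These vectors vanish when [x] and [z]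
    are (-1, 0); the entries (1, 1) and (1, 2) then relate [y] and [w]. *)
Lemma fold_turn_entries (R : realType) (a : R) (x y z w : R * R) : sin a != 0 ->
  fold_mx a x *m turn_mx y = turn_mx (w.1, - w.2) *m fold_mx a z ->
  [/\ x.1 = z.1,
      cos a * (1 + x.1) * y.1 - x.2 * y.2 = cos a * (1 + z.1) /\
      cos a * (1 + x.1) * y.2 + x.2 * y.1 = z.2,
      cos a * (1 + z.1) * w.1 + z.2 * w.2 = cos a * (1 + x.1) /\
      z.2 * w.1 - cos a * (1 + z.1) * w.2 = x.2 &
      x = (-1, 0) -> z = (-1, 0) -> y.1 = w.1 /\ y.2 = - w.2].
Proof.
move=> s0 E; have cs := cos2Dsin2 a.
pose i0 : 'I_3 := ord0; pose i1 : 'I_3 := Ordinal (isT : (1 < 3)%N).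
pose i2 : 'I_3 := Ordinal (isT : (2 < 3)%N).
have e i j := congr1 (fun M : 'M[R]_3 => M i j) E.
have := (e i0 i0, e i0 i1, e i0 i2, e i1 i0, e i2 i0, (e i1 i1, e i1 i2)).
rewrite !mxE !big_ord_recl !big_ord0 !mxE /=.
rewrite !(mul0r, mulr0, mul1r, mulr1, add0r, addr0) => -[[[[[]]]]].
move=> e00 e01 e02 e10 e20 [e11 e12]; split.
- apply: (mulfI (expf_neq0 2 s0)); lra.
- by split; apply: (mulfI s0); lra.
- by split; apply: (mulfI s0); lra.
- move=> xE zE; move: e11 e12; rewrite xE zE /= => e11 e12.
  have cs' : cos a ^+ 2 = 1 - sin a ^+ 2 by rewrite -cs; ring.
  by move: e11 e12; rewrite cs'; split; lra.
Qed.

Lemma miura_half_tans (R : realType) (a : R) (x y z w : opcR R) :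
  sin a != 0 -> cos a != 0 ->
  fold_mx a (opc_angle_pt x) *m turn_mx (opc_angle_pt y) =
  turn_mx ((opc_angle_pt w).1, - (opc_angle_pt w).2) *m fold_mx a (opc_angle_pt z)
  <-> [\/ [/\ y = fin 0, z = x & w = fin 0],
       [/\ y = opc_scale (- (cos a)^-1) x, z = opc_scale (-1) x
         & w = opc_scale (- (cos a)^-1) x] |
       [/\ x = infty, z = infty & w = opc_scale (-1) y]].
Proof.
move=> s0 c0; have cs := cos2Dsin2 a; split; last first.
  case=> [[-> -> ->]|[-> -> ->]|[-> -> ->]];
    apply/matrixP => i j; rewrite !mxE !big_ord_recl !big_ord0 !mxE.
  - by case: i => [[|[|[|//]]]] ?; case: j => [[|[|[|//]]]] ? /=; field.
  - have s2 : sin a ^+ 2 = 1 - cos a ^+ 2 by rewrite -cs; ring.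
    case: x => [t|]; last first.
      by case: i => [[|[|[|//]]]] ?; case: j => [[|[|[|//]]]] ? /=; ring.
    have t0 := sqr1D_neq0 t; have ct0 := sqrDsqr_neq0 t c0.
    by case: i => [[|[|[|//]]]] ?; case: j => [[|[|[|//]]]] ? /=;
      rewrite ?s2; field; rewrite ?mulN1r ?sqrrN ?t0 ?ct0 ?c0.
  - case: y => [t|]; last first.
      by case: i => [[|[|[|//]]]] ?; case: j => [[|[|[|//]]]] ? /=; ring.
    have s2 : sin a ^+ 2 = 1 - cos a ^+ 2 by rewrite -cs; ring.
    have t0 := sqr1D_neq0 t.
    by case: i => [[|[|[|//]]]] ?; case: j => [[|[|[|//]]]] ? /=;
      rewrite ?s2; field; rewrite ?mulN1r ?sqrrN ?t0.
move=> /(fold_turn_entries s0)[].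
(* An infinite [x] forces [z] to be infinite, since the first coordinate is -1 only there; the
   degenerate clause then gives [w]. *)
case: x => [t|] /=; last first.
  case: z => [u|] /= e1 _ _ e2.
    have := @opc_angle_pt_inj R (fin u) infty; rewrite /= -e1.
    have : 2 / (1 + u ^+ 2) = 0 :> R.
      by rewrite -[RHS](subrr (-1)) {1}e1; field; exact: sqr1D_neq0.
    by move/eqP; rewrite mulf_eq0 invr_eq0 (negPf (sqr1D_neq0 u)) pnatr_eq0.
  case: e2 => // yw1 yw2; apply: Or33; split=> //; apply: opc_angle_pt_inj.
  move: yw1 yw2; case: y => [v|] /= yw1 yw2.
    by rewrite [LHS]surjective_pairing -yw1 -[X in (_, X)]opprK -yw2; congr pair;
      field; exact: sqr1D_neq0.
  by rewrite [LHS]surjective_pairing -yw1 -[X in (_, X)]opprK -yw2 oppr0.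
have t0 := sqr1D_neq0 t.
case: z => [u|] /= e1 [e2 e3] [e4 e5] _; last first.
  have : 2 / (1 + t ^+ 2) = 0 :> R.
    by rewrite -[RHS](subrr (-1)) -{1}e1; field.
  by move/eqP; rewrite mulf_eq0 invr_eq0 (negPf t0) pnatr_eq0.
have u0 := sqr1D_neq0 u.
have tu : t ^+ 2 = u ^+ 2.
  have : (1 - t ^+ 2) / (1 + t ^+ 2) * ((1 + t ^+ 2) * (1 + u ^+ 2))
       = (1 - u ^+ 2) / (1 + u ^+ 2) * ((1 + t ^+ 2) * (1 + u ^+ 2)) by rewrite e1.
  rewrite mulrA divfK// [X in _ = _ * X -> _]mulrC mulrA divfK//; lra.
have k0 : 2 / (1 + t ^+ 2) != 0 :> R by rewrite mulf_neq0// invr_neq0.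
have kE (s : R) : s *+ 2 / (1 + t ^+ 2) = 2 / (1 + t ^+ 2) * s by field.
have kE1 : 1 + (1 - t ^+ 2) / (1 + t ^+ 2) = 2 / (1 + t ^+ 2) by field.
rewrite -tu kE1 (kE t) (kE u) in e2 e3 e4 e5.
(* The two plane vectors are now k (cos a, t) and k (cos a, u), so the nonzero factor [k] can be
   abstracted and cancelled. *)
move: (2 / (1 + t ^+ 2)) k0 e2 e3 e4 e5 => k k0 e2 e3 e4 e5.
have /eqP := tu; rewrite eqf_sqr => /orP[/eqP tuE|/eqP tuE]; last first.
  have {tuE}uE : u = - t by rewrite tuE opprK.
  rewrite uE in e3 e4 e5 *; apply: Or32; split; last 1 first.
  - by apply: rotate_flip => //; apply: (mulfI k0); lra.
  - by apply: rotate_flip => //; apply: (mulfI k0); lra.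
  - by rewrite mulN1r.
rewrite -tuE in e3 e4 e5 *; apply: Or31; split=> //.
- by apply: (@rotate_fix _ (cos a) t) => //; apply: (mulfI k0); lra.
(* The equations for [w] describe the inverse rotation; reflecting the plane makes it a rotation by
   [w] fixing (cos a, -t). *)
- by apply: (@rotate_fix _ (cos a) (- t)) => //; apply: (mulfI k0); lra.
Qed.

Lemma miura_solutions (R : realType) (a : R) (x y z w : opcR R) :
  sin a != 0 -> cos a != 0 ->
  solutions a a (pi - a) (pi - a) (x, y, z, w) <->
  [\/ [/\ y = fin 0, z = x & w = fin 0],
      [/\ y = opc_scale (- (cos a)^-1) x, z = opc_scale (-1) x
        & w = opc_scale (- (cos a)^-1) x] |
      [/\ x = infty, z = infty & w = opc_scale (-1) y]].
Proof.
move=> s0 c0; rewrite -miura_half_tans//.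
have angle_ptN r : angle_pt (- r) = ((angle_pt r).1, - (angle_pt r).2).
  by rewrite /angle_pt cosN sinN.
split=> [[rx [ry [rz [rw [/miura_closesP E [-> -> -> ->]]]]]]|E].
  by rewrite -!angle_ptE -angle_ptN.
have [rx xE] := half_tan_surj x; have [ry yE] := half_tan_surj y.
have [rz zE] := half_tan_surj z; have [rw wE] := half_tan_surj w.
exists rx, ry, rz, rw; split; last by rewrite /half_tans xE yE zE wE.
by apply/miura_closesP; rewrite angle_ptN !angle_ptE xE yE zE wE.
Qed.

(** * Smooth maps *)

(** Differentiability depends only on the germ: the first-order expansion of [f] transfers to [g],
    and uniqueness of the differential identifies 'd g p with 'd f p. *)
Lemma near_eq_differentiable (R : realType) (V W : normedModType R)
    (f g : V -> W) (p : V) :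
  (\near p, f p = g p) -> differentiable f p -> differentiable g p.
Proof.
move=> fg df; have [cdf _] := (diff_locallyP p f).1 df.
have eg : g \o shift p = cst (g p) + 'd f p +o_ 0 id.
  have /eqaddoP fo := diff_locally df.
  apply/eqaddoP => e e0; have := fo e e0.
  apply: filter_app.
  have : \forall y \near (0 : V), f (y + p) = g (y + p).
    by move/nbhs0P: fg; apply: filterS => y; rewrite addrC.
  apply: filterS => y fgy; rewrite /= !fctE /= fgy.
  by have /= <- := nbhs_singleton fg.
have dg : 'd g p = 'd f p :> (V -> W).
  exact: diff_unique.
by apply/diff_locallyP; rewrite dg; split.
Qed.

(** Rules of differentiation hold only at points of [U], whereas [Ck_on] speaks of the whole
    function ['D_v f]. As [U] is open, agreement on [U] is agreement near each of its points and so
    passes to derivatives. *)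
Lemma Ck_on_ext (R : realType) (V W : normedModType R) (U : set V) k
    (f g : V -> W) : open U -> {in U, f =1 g} -> Ck_on k U f -> Ck_on k U g.
Proof.
move=> oU; elim: k f g => [|k IH] f g fg /=.
  move=> cf p Up; have fgp : \near p, f p = g p.
    by apply: filterS (open_nbhs_nbhs (conj oU Up)) => x Ux; apply: fg; rewrite inE.
  rewrite /prop_for /continuous_at -(fg p) ?inE//.
  by apply: cvg_trans (cf p Up); apply: near_eq_cvg.
have fgp p : U p -> \near p, f p = g p.
  move=> Up.
  by apply: filterS (open_nbhs_nbhs (conj oU Up)) => x Ux; apply: fg; rewrite inE.
move=> [df Df]; split=> [p Up|v].
  by apply: near_eq_differentiable (df _ Up); exact: fgp.
apply: IH (Df v) => p; rewrite inE => Up.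
by apply: near_eq_derive; exact: fgp.
Qed.

Section Ck_closure.
Context {R : realType} {V : normedModType R} (U : set V).
Hypothesis oU : open U.

Lemma Ck_on_continuous (W : normedModType R) k (f : V -> W) :
  Ck_on k U f -> Ck_on 0 U f.
Proof.
case: k => // k [df _] p Up.
by apply: differentiable_continuous; exact: df.
Qed.

Lemma Ck_onS (W : normedModType R) k (f : V -> W) :
  Ck_on k.+1 U f -> Ck_on k U f.
Proof.
elim: k f => [|k IH] f; first exact: Ck_on_continuous.
by move=> [df Df]; split=> // v; exact: IH (Df v).
Qed.

Lemma Ck_on_cst (W : normedModType R) k (w : W) : Ck_on k U (cst w : V -> W).
Proof.
elim: k w => [|k IH] w /=; first by move=> p _; exact: cvg_cst.
split=> [p _|v]; first exact: differentiable_cst.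
apply: Ck_on_ext (IH 0) => // p _.
by rewrite derive_cst.
Qed.

Lemma Ck_on_linear (W : normedModType R) k (f : {linear V -> W}) :
  continuous f -> Ck_on k U f.
Proof.
move=> cf; case: k => [|k] /=; first by move=> p _; exact: cf.
split=> [p _|v]; first exact: linear_differentiable.
apply: Ck_on_ext (Ck_on_cst k (f v)) => // p _ /=.
by rewrite deriveE ?diff_lin//; exact: linear_differentiable.
Qed.

Lemma Ck_on_pair (W W' : normedModType R) k (f : V -> W) (g : V -> W') :
  Ck_on k U f -> Ck_on k U g -> Ck_on k U (fun p => (f p, g p)).
Proof.
elim: k f g => [|k IH] f g.
  by move=> cf cg p Up; apply: cvg_pair; [exact: cf|exact: cg].
move=> [df Df] [dg Dg]; split=> [p Up|v].
  by apply: differentiable_pair; [exact: df|exact: dg].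
apply: Ck_on_ext (IH _ _ (Df v) (Dg v)) => // p; rewrite inE => Up.
have dfp := df _ Up; have dgp := dg _ Up.
by rewrite !deriveE ?diff_pair//; exact: differentiable_pair.
Qed.

Lemma Ck_onD (W : normedModType R) k (f g : V -> W) :
  Ck_on k U f -> Ck_on k U g -> Ck_on k U (f + g).
Proof.
elim: k f g => [|k IH] f g.
  by move=> cf cg p Up; apply: cvgD; [exact: cf|exact: cg].
move=> [df Df] [dg Dg]; split=> [p Up|v].
  by apply: differentiableD; [exact: df|exact: dg].
apply: Ck_on_ext (IH _ _ (Df v) (Dg v)) => // p; rewrite inE => Up.
rewrite deriveD//; first exact: diff_derivable (df _ Up).
exact: diff_derivable (dg _ Up).
Qed.

(** In the Leibniz rule the undifferentiated factors reappear, so they are lowered from order k + 1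
    to order k by [Ck_onS]. *)
Lemma Ck_onM k (f g : V -> R) :
  Ck_on k U f -> Ck_on k U g -> Ck_on k U (f * g).
Proof.
elim: k f g => [|k IH] f g.
  by move=> cf cg p Up; apply: cvgM; [exact: cf|exact: cg].
move=> Cf Cg; have [df Df] := Cf; have [dg Dg] := Cg; split=> [p Up|v].
  by apply: differentiableM; [exact: df|exact: dg].
apply: Ck_on_ext (Ck_onD (IH _ _ (Ck_onS Cf) (Dg v)) (IH _ _ (Ck_onS Cg) (Df v))) => //.
move=> p; rewrite inE => Up.
rewrite deriveM//; first exact: diff_derivable (df _ Up).
exact: diff_derivable (dg _ Up).
Qed.

Lemma Ck_onV k (f : V -> R) : (forall p, U p -> f p != 0) ->
  Ck_on k U f -> Ck_on k U (fun p => (f p)^-1).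
Proof.
move=> f0; elim: k => [|k IH] Cf.
  by move=> p Up; apply: cvgV; [exact: f0|exact: Cf].
have CVf := IH (Ck_onS Cf); have [df Df] := Cf; split=> [p Up|v].
  by apply: differentiableV; [exact: df|exact: f0].
(* The derivative of the inverse, - f^-1 f^-1 D f, is a product of functions already known to be of
   class C^k. *)
have C := Ck_onM (Ck_onM (Ck_onM (Ck_on_cst k (-1 : R)) CVf) CVf) (Df v).
apply: Ck_on_ext C => //.
move=> p; rewrite inE => Up.
rewrite deriveV//; [|exact: f0|exact: diff_derivable (df _ Up)].
by rewrite !fctE /= !mulN1r mulNr scaleNr /GRing.scale/= expr2 invfM mulNr.
Qed.

End Ck_closure.

(** * Curves on the torus *)

Lemma smooth_onW (R : realType) (V W : normedModType R) (A U : set V) (f : V -> W) :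
  open U -> A `<=` U -> (forall k, Ck_on k U f) -> smooth_on A f.
Proof. by move=> oU AU Cf p /AU Up; exists U, f. Qed.

(** A globally smooth left inverse [pr] of the parametrization, in practice a coordinate projection,
    is a two-sided inverse on the image. *)
Lemma graph_diffeomorphic (R : realType) (B : set (config R))
    (h : R * R -> (R * R) * (R * R) * (R * R) * (R * R)) pr :
  smooth_on (@circle R) h -> (forall k, Ck_on k setT pr) ->
  cancel h pr -> on_torus B = h @` @circle R -> diffeomorphic_to_circle B.
Proof.
move=> sh sp hK BE; exists pr, h; split=> //.
- by apply: (smooth_onW (U := setT)) => //; exact: openT.
- by move=> p; rewrite BE => -[q cq <-]; rewrite hK.
- by move=> q cq; rewrite BE hK; split=> //; exists q.
Qed.

Definition conj_pt (R : realType) (p : R * R) : R * R := (p.1, - p.2).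

Lemma opc_angle_ptN (R : realType) (t : opcR R) :
  opc_angle_pt (opc_scale (-1) t) = conj_pt (opc_angle_pt t).
Proof.
case: t => [t|]; rewrite /conj_pt/= ?oppr0// mulN1r sqrrN; congr pair.
by rewrite mulNrn mulNr.
Qed.

(* The map of the circle that multiplies half-tangents by [k]: with [p.1] the
   cosine, the squared half-tangent is [(1 - p.1) / (1 + p.1)]. *)
Definition scale_den (R : realType) (k : R) (p : R * R) : R :=
  1 + k ^+ 2 + (1 - k ^+ 2) * p.1.

Definition scale_pt (R : realType) (k : R) (p : R * R) : R * R :=
  ((1 - k ^+ 2 + (1 + k ^+ 2) * p.1) * (scale_den k p)^-1,
   (k *+ 2) * p.2 * (scale_den k p)^-1).

Lemma scale_den_fin (R : realType) (k t : R) :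
  scale_den k (opc_angle_pt (fin t)) = 2 * (1 + (k * t) ^+ 2) / (1 + t ^+ 2).
Proof. by rewrite /scale_den/=; field; exact: sqr1D_neq0. Qed.

Lemma scale_den_infty (R : realType) (k : R) :
  scale_den k (opc_angle_pt infty) = 2 * k ^+ 2.
Proof. by rewrite /scale_den/=; ring. Qed.

Lemma opc_angle_ptZ (R : realType) (k : R) (t : opcR R) : k != 0 ->
  opc_angle_pt (opc_scale k t) = scale_pt k (opc_angle_pt t).
Proof.
move=> k0; case: t => [t|]; rewrite /scale_pt ?scale_den_fin ?scale_den_infty /=.
  have t0 := sqr1D_neq0 t; have kt0 := sqr1D_neq0 (k * t).
  by congr pair; field; rewrite t0 kt0.
by congr pair; field.
Qed.

(** Back in half-tangents the denominator is visibly positive, at infinity because [k] is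
    nonzero. *)
Lemma scale_den_neq0 (R : realType) (k : R) (p : R * R) : k != 0 ->
  circle p -> scale_den k p != 0.
Proof.
move=> k0; rewrite -opc_angle_pt_image => -[[t|] _ <-].
  by rewrite scale_den_fin !mulf_neq0 ?invr_neq0 ?sqr1D_neq0.
by rewrite scale_den_infty mulf_neq0 ?expf_neq0.
Qed.

Section circle_smoothness.
Context {R : realType} (U : set (R * R)).
Hypothesis oU : open U.

Lemma Ck_on_fst k : Ck_on k U (fst : R * R -> R).
Proof. by apply: (Ck_on_linear oU k (f := fst)) => p; exact: cvg_fst. Qed.

Lemma Ck_on_snd k : Ck_on k U (snd : R * R -> R).
Proof. by apply: (Ck_on_linear oU k (f := snd)) => p; exact: cvg_snd. Qed.

Lemma Ck_on_id k : Ck_on k U (id : R * R -> R * R).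
Proof. by apply: (Ck_on_linear oU k (f := idfun)) => p; exact: cvg_id. Qed.

Lemma Ck_on_torus (h1 h2 h3 h4 : R * R -> R * R) k :
  Ck_on k U h1 -> Ck_on k U h2 -> Ck_on k U h3 -> Ck_on k U h4 ->
  Ck_on k U (fun p => (h1 p, h2 p, h3 p, h4 p)).
Proof.
move=> C1 C2 C3 C4; have C12 := Ck_on_pair oU C1 C2.
have C123 := Ck_on_pair oU C12 C3.
by have C := Ck_on_pair oU C123 C4; exact: C.
Qed.

Lemma Ck_on_conj k : Ck_on k U (@conj_pt R).
Proof.
apply: Ck_on_pair => //; first exact: Ck_on_fst.
have := Ck_onM oU (Ck_on_cst oU k (-1 : R)) (Ck_on_snd k).
by apply: Ck_on_ext => // p _; rewrite !fctE mulN1r.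
Qed.

Lemma Ck_on_scale (c : R) k : (forall p, U p -> scale_den c p != 0) ->
  Ck_on k U (scale_pt c).
Proof.
move=> D0.
(* The denominator and the first numerator of [scale_pt] are both affine in [p.1]. *)
have Caff (a b : R) : Ck_on k U (fun p => a + b * p.1).
  have bC := Ck_onM oU (Ck_on_cst oU k (b : R)) (Ck_on_fst k).
  exact: (Ck_onD oU (Ck_on_cst oU k (a : R)) bC).
have CV : Ck_on k U (fun p => (scale_den c p)^-1) by apply: (Ck_onV oU); last exact: Caff.
apply: (Ck_on_pair oU).
  exact: (Ck_onM oU (Caff (1 - c ^+ 2) (1 + c ^+ 2)) CV).
exact: (Ck_onM oU (Ck_onM oU (Ck_on_cst oU k (c *+ 2 : R)) (Ck_on_snd k)) CV).
Qed.

End circle_smoothness.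

Lemma on_torusE (R : realType) (B : set (config R)) :
  on_torus B = [set p | exists x y z w, B (x, y, z, w) /\
    p = (opc_angle_pt x, opc_angle_pt y, opc_angle_pt z, opc_angle_pt w)].
Proof.
apply/seteqP; split=> p.
  move=> [rx [ry [rz [rw [Br ->]]]]]; rewrite !angle_ptE.
  by exists (half_tan rx), (half_tan ry), (half_tan rz), (half_tan rw).
move=> [x [y [z [w [+ ->]]]]].
have [rx <-] := half_tan_surj x; have [ry <-] := half_tan_surj y.
have [rz <-] := half_tan_surj z; have [rw <-] := half_tan_surj w.
by move=> Br; exists rx, ry, rz, rw; split=> //; rewrite !angle_ptE.
Qed.

Lemma on_torus_range (R : realType) (f1 f2 f3 f4 : opcR R -> opcR R)
    (h1 h2 h3 h4 : R * R -> R * R) :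
  (forall t, opc_angle_pt (f1 t) = h1 (opc_angle_pt t)) ->
  (forall t, opc_angle_pt (f2 t) = h2 (opc_angle_pt t)) ->
  (forall t, opc_angle_pt (f3 t) = h3 (opc_angle_pt t)) ->
  (forall t, opc_angle_pt (f4 t) = h4 (opc_angle_pt t)) ->
  on_torus [set q | exists t, q = (f1 t, f2 t, f3 t, f4 t)] =
  (fun p => (h1 p, h2 p, h3 p, h4 p)) @` @circle R.
Proof.
move=> E1 E2 E3 E4; rewrite on_torusE -opc_angle_pt_image; apply/seteqP; split=> p.
  move=> [x [y [z [w [[t [-> -> -> ->]] ->]]]]].
  by exists (opc_angle_pt t); [exists t|rewrite E1 E2 E3 E4].
move=> [_ [t _ <-] <-]; exists (f1 t), (f2 t), (f3 t), (f4 t).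
by split; [exists t|rewrite E1 E2 E3 E4].
Qed.

(** Smoothness on the circle asks for an extension to open sets; this locus is one on which the
    formula of [scale_pt] is smooth. *)
Lemma open_scale_den (R : realType) (k : R) :
  open [set p : R * R | scale_den k p != 0].
Proof.
apply: (@open_comp _ _ (scale_den k) [set x | x != 0]); last exact: open_neq.
move=> p _; apply: cvgD; first exact: cvg_cst.
by apply: cvgM; [exact: cvg_cst|exact: cvg_fst].
Qed.

(** * Completion over the one-point compactification *)

Lemma opc_hausdorff (R : realType) : hausdorff_space (opcR R).
Proof.
apply: one_point_compactification_hausdorff; first exact: locally_compactR.
exact: Rhausdorff.
Qed.

Lemma hausdorff_pair (S T : topologicalType) :
  hausdorff_space S -> hausdorff_space T -> hausdorff_space (S * T)%type.
Proof.
move=> hS hT [s t] [s' t'] st; congr pair.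
  apply: hS => A B As Bs.
  by have [[u v] [/= Au Bu]] := st _ _ (cvg_fst As) (cvg_fst Bs); exists u.
apply: hT => A B At Bt.
by have [[u v] [/= Au Bu]] := st _ _ (cvg_snd At) (cvg_snd Bt); exists v.
Qed.

Lemma config_hausdorff (R : realType) : hausdorff_space (config R).
Proof. by do 3!(apply: hausdorff_pair; last exact: opc_hausdorff); exact: opc_hausdorff. Qed.

(** A neighbourhood of infinity contains the complement of a compact set, which is bounded and
    therefore misses some real number. *)
Lemma fin_dense (R : realType) : closure (range (@fin R)) = setT.
Proof.
rewrite -subTset => -[t _ B Bt|_ B [K [cK _] KB]].
  by exists (fin t); split; [exists t|exact: nbhs_singleton].
have [M [_ KM]] := compact_bounded cK.
have [t Kt] : exists t, ~ K t.
  have M1 : M < `|M| + 1 by rewrite (le_lt_trans (ler_norm M))// ltrDl.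
  exists (`|M| + 2) => Kt; have /= := KM _ M1 _ Kt.
  by rewrite ger0_norm ?addr_ge0//; lra.
by exists (fin t); split; [exists t|apply: KB; left; exists t].
Qed.

(** At infinity, the complement of a compact [K] pulls back to the complement of the compact set
    c^-1 K. *)
Lemma opc_scale_continuous (R : realType) (c : R) : c != 0 ->
  continuous (opc_scale c).
Proof.
move=> c0 [t|] B /=.
  move=> Bt; have := @mulrl_continuous R c t.
  by move=> /(_ (@fin R @^-1` B) Bt).
move=> [K [cK clK] KB].
exists (( *%R c^-1) @` K).
  have cK' : compact (( *%R c^-1) @` K).
    apply: continuous_compact => //; apply: continuous_subspaceT => x.
    exact: mulrl_continuous.
  by split=> //; apply: compact_closed => //; exact: Rhausdorff.
move=> _ [[t Kt <-]|->]; apply: KB; last by right.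
by left; exists (c * t) => // Kct; apply: Kt; exists (c * t) => //; rewrite mulKf.
Qed.

Lemma completed_range (R : realType) (f : opcR R -> config R) :
  continuous f -> (forall t, finite_configs (f (fin t))) -> completed (range f).
Proof.
move=> cf ff; apply/seteqP; split.
  have clf : closed (range f).
    apply: compact_closed; first exact: config_hausdorff.
    apply: continuous_compact; last exact: one_point_compactification_compact.
    exact: continuous_subspaceT.
  by rewrite {2}((closure_id _).1 clf); apply: closureS; exact: subIsetl.
move=> _ [x _ <-] B /cf Bx.
have : closure (range (@fin R)) x by rewrite fin_dense.
move=> /(_ _ Bx)[_ [[t _ <-]] Bt]; exists (f (fin t)); split=> //.
Qed.

Lemma range_exists (S T : Type) (f : S -> T) :
  [set q | exists x, q = f x] = range f.
Proof. by apply/seteqP; split=> [_ [x ->]|_ [x _ <-]]; exists x. Qed.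

Lemma continuous_pair (S T U : topologicalType) (f : S -> T) (g : S -> U) :
  continuous f -> continuous g -> continuous (fun x => (f x, g x)).
Proof. by move=> cf cg x; apply: cvg_pair; [exact: cf|exact: cg]. Qed.

(** * Assembly of the three branches *)

Theorem mainTheorem6 (R : realType) (alpha beta gamma delta : R)
  (halpha : 0 < alpha < pi) (hbeta : 0 < beta < pi)
  (hgamma : 0 < gamma < pi) (hdelta : 0 < delta < pi)
  (hab : alpha = beta) (hbc : beta = pi - gamma)
  (hcd : pi - gamma = pi - delta) (hne : alpha <> pi / 2) :
  let sols := solutions alpha beta gamma delta in
  let branch1 : set (config R) :=
    [set q | exists x : opcR R, q = (x, fin 0, x, fin 0)] in
  let branch2 : set (config R) :=
    [set q | exists x : opcR R,
       q = (x, opc_scale (- (cos alpha)^-1) x, opc_scale (-1) x,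
            opc_scale (- (cos alpha)^-1) x)] in
  let branch3 : set (config R) :=
    [set q | exists y : opcR R, q = (infty, y, infty, opc_scale (-1) y)] in
  (* (i) *)
  (finite_solutions alpha beta gamma delta
     = (branch1 `|` branch2) `&` @finite_configs R /\
   [/\ branch1 `<=` sols, completed branch1 & diffeomorphic_to_circle branch1] /\
   [/\ branch2 `<=` sols, completed branch2 & diffeomorphic_to_circle branch2] /\
   branch1 <> branch2) /\
  (* (ii) *)
  (solutions_at_infinity alpha beta gamma delta = branch3 /\
   diffeomorphic_to_circle branch3 /\
   branch3 <> branch1 /\ branch3 <> branch2).
Proof.
move=> sols branch1 branch2 branch3.
have gE : gamma = pi - alpha by rewrite hab hbc opprB addrC subrK.
have dE : delta = pi - alpha by rewrite -gE; apply: oppr_inj; exact: (addrI pi (esym hcd)).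
rewrite {hbeta hgamma hdelta hbc hcd}/sols {sols} -hab gE dE.
have s0 : sin alpha != 0 by rewrite gt_eqF// sin_gt0_pi.
have c0 : cos alpha != 0.
  apply/eqP => c0; apply: hne; apply: cos_inj; rewrite ?cos_pihalf//.
    by case/andP: halpha => *; rewrite in_itv/= !ltW.
  by have := pi_gt0 R; rewrite in_itv/=; lra.
set k := - (cos alpha)^-1 in branch2 *.
have k0 : k != 0 by rewrite oppr_eq0 invr_eq0.
have n10 : -1 != 0 :> R by rewrite oppr_eq0 oner_eq0.
(* Everything about the solution set is read off from this decomposition; the finite and infinite
   parts are then separated inside it. *)
have solE : solutions alpha alpha (pi - alpha) (pi - alpha) =
    branch1 `|` branch2 `|` branch3.
  apply/seteqP; split=> -[[[x y] z] w].
    move=> /(miura_solutions _ _ _ _ s0 c0)[[-> -> ->]|[-> -> ->]|[-> -> ->]].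
    - by left; left; exists x.
    - by left; right; exists x.
    - by right; exists y.
  move=> H; apply/miura_solutions => //.
  by case: H => [[]|] [t [-> -> -> ->]]; [apply: Or31|apply: Or32|apply: Or33].
rewrite /finite_solutions /solutions_at_infinity solE.
have b3F : branch3 `&` @finite_configs R = set0.
  by rewrite -subset0 => _ [[y ->] [? [? [? [? []]]]]].
have cid : continuous (id : opcR R -> opcR R) by move=> t; exact: cvg_id.
have ccst0 : continuous (cst (fin 0) : opcR R -> opcR R) by exact: cst_continuous.
have ck := opc_scale_continuous k0; have cN := opc_scale_continuous n10.
have pt0 (t : opcR R) : opc_angle_pt (fin 0 : opcR R) = cst (1, 0) (opc_angle_pt t).
  by rewrite /= expr0n /= subr0 addr0 mul0rn mul0r divr1.
have ptk t := opc_angle_ptZ t k0.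
have oT : open [set: R * R] by exact: openT.
have CT (h : _ -> (R * R) * (R * R) * (R * R) * (R * R)) :
    (forall n, Ck_on n setT h) -> smooth_on (@circle R) h.
  by move=> Ch; apply: (smooth_onW oT).
have Cid := Ck_on_id oT; have Ccst n p := Ck_on_cst oT n (p : R * R).
have Cconj := Ck_on_conj oT.
have oT4 : open [set: (R * R) * (R * R) * (R * R) * (R * R)] by exact: openT.
have C1 n : Ck_on n setT (fun p : (R * R) * (R * R) * (R * R) * (R * R) => p.1.1.1).
  apply: (Ck_on_linear oT4 n (f := fst \o fst \o fst)) => p /=.
  by do 2!(apply: cvg_comp; first exact: cvg_fst); exact: cvg_fst.
(* Branches 1 and 2 are projected to the angle of [x]; on branch 3 that angle is constant, so the
   angle of [y] is used. *)
have C2 n : Ck_on n setT (fun p : (R * R) * (R * R) * (R * R) * (R * R) => p.1.1.2).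
  apply: (Ck_on_linear oT4 n (f := snd \o fst \o fst)) => p /=.
  by do 2!(apply: cvg_comp; first exact: cvg_fst); exact: cvg_snd.
have d1 : diffeomorphic_to_circle branch1.
  apply: (@graph_diffeomorphic R branch1 (fun p => (p, (1, 0), p, (1, 0))) _ _ C1) => //.
    apply: CT => n.
    exact: (Ck_on_torus oT (Cid n) (Ccst n (1, 0)) (Cid n) (Ccst n (1, 0))).
  exact: (on_torus_range (fun=> erefl) pt0 (fun=> erefl) pt0).
have d2 : diffeomorphic_to_circle branch2.
  apply: (@graph_diffeomorphic R branch2 (fun p => (p, scale_pt k p, conj_pt p, scale_pt k p)) _ _ C1) => //.
    (* [scale_pt k] is rational, so smoothness is obtained on the open locus where its denominator
       does not vanish. *)
    have oU := @open_scale_den R k.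
    apply: (smooth_onW oU) => [p|n]; first exact: scale_den_neq0.
    have Cs := Ck_on_scale oU n (fun p Up => Up).
    exact: (Ck_on_torus oU (Ck_on_id oU n) Cs (Ck_on_conj oU n) Cs).
  exact: (on_torus_range (fun=> erefl) ptk (@opc_angle_ptN R) ptk).
have d3 : diffeomorphic_to_circle branch3.
  apply: (@graph_diffeomorphic R branch3 (fun p => ((-1, 0), p, (-1, 0), conj_pt p)) _ _ C2) => //.
    apply: CT => n.
    exact: (Ck_on_torus oT (Ccst n (-1, 0)) (Cid n) (Ccst n (-1, 0)) (Cconj n)).
  exact: (@on_torus_range R (cst infty) id (cst infty) _ (cst (- 1, 0)) id (cst (- 1, 0)) _
    (fun=> erefl) (fun=> erefl) (fun=> erefl) (@opc_angle_ptN R)).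
split; split.
- by rewrite setIUl b3F setU0.
- split; [split|split; [split|]] => //.
  + by move=> q; left; left.
  + rewrite /branch1 range_exists; apply: completed_range.
      exact: continuous_pair (continuous_pair (continuous_pair cid ccst0) cid) ccst0.
    by move=> t; exists t, 0, t, 0.
  + by move=> q; left; right.
  + rewrite /branch2 range_exists; apply: completed_range.
      exact: continuous_pair (continuous_pair (continuous_pair cid ck) cN) ck.
    by move=> t; exists t, (k * t), (-1 * t), (k * t).
  (* At x = 1 the third coordinate is 1 on branch 1 and -1 on branch 2. *)
  + move=> b12; have : branch2 (fin 1, fin 0, fin 1, fin 0) by rewrite -b12; exists (fin 1).
    move=> [[t|] []] // <- _; rewrite mulr1 => t1 _; lra.
(* The points at infinity completing branches 1 and 2 lie on branch 3, at y = 0 and y = infinity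
   respectively. *)
- apply/seteqP; split=> q.
    move=> [[[]|] [x ->] nF].
    + case: x nF => [t|_]; first by case; exists t, 0, t, 0.
      by exists (fin 0); rewrite /= mulr0.
    + case: x nF => [t|_]; first by case; exists t, (k * t), (-1 * t), (k * t).
      by exists infty.
    + by exists x.
  move=> b3q; split; first by right.
  by move=> Fq; have : (branch3 `&` @finite_configs R) q by []; rewrite b3F.
(* The flat state, all half-tangents zero, lies on branches 1 and 2 but not on branch 3. *)
- split=> //; split=> b3.
    have : branch3 (fin 0, fin 0, fin 0, fin 0) by rewrite b3; exists (fin 0).
    by move=> [y []].
  have : branch3 (fin 0, fin 0, fin 0, fin 0) by rewrite b3; exists (fin 0); rewrite /= !mulr0.
  by move=> [y []].
Qed.
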